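(* In the setting described in the context (an invariant section $i$ of $H\sim(F,G)$ over $u$ and the associated invariant bundle map $f$), assume the fibers of $X,Y$ are Banach spaces and $F_m(\cdot),G_m(\cdot)$ are $C^1$ for every $m\in M$, and: (a) there are $M_0>0$ and $0<\gamma\le1$ such that $|DF_m(z_1)-DF_m(z_2)|\le M_0|z_1-z_2|^\gamma$ and $|DG_m(z_1)-DG_m(z_2)|\le M_0|z_1-z_2|^\gamma$ for all $z_1,z_2\in X_m\times Y_{u(m)}$ and $m\in M$; (b) $\lambda_s\lambda_u<1$ and $\lambda_s^{*\gamma\theta}\lambda_s\lambda_u<1$, where $0<\theta\le1$ (notation of the context). Then $f_m$ is $C^1$ with derivative $K^1_m(x)=Df_m(x)$, and $K^1_m(\cdot)$ is $C^{0,\gamma\theta}$ uniformly in $m$: there is a constant $C$ independent of $m$ with $|K^1_m(x_1)-K^1_m(x_2)|\le C|x_1-x_2|^{\gamma\theta}$ for all $x_1,x_2\in X_m$. In particular, if $F_m(\cdot),G_m(\cdot)\in C^{1,1}$ uniformly for $m$ and $\lambda_s\lambda_u<1$, $\lambda_s^2\lambda_u<1$, then $K^1_m(\cdot)\in C^{0,1}$ uniformly for $m$.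
   Context: A bundle with metric fibers $(X,M,\pi)$ is a surjection $\pi:X\to M$ of sets whose fibers $X_m$ are complete metric spaces (metrics written $|x-y|$). $H\sim(F,G):X\times Y\to X\times Y$ is a bundle correspondence over $u:M\to M$ with generating bundle map: $F_m:X_m\times Y_{u(m)}\to X_{u(m)}$, $G_m:X_m\times Y_{u(m)}\to Y_m$ and $(x_2,y_2)\in H_m(x_1,y_1)\iff y_1=G_m(x_1,y_2),x_2=F_m(x_1,y_2)$. Conditions for $H_m$ (for all $(x_1,y_1)\times(x_2,y_2)$, $(x_1',y_1')\times(x_2',y_2')\in\operatorname{Graph}H_m$, functions evaluated at $m$): (A)$(\alpha;\alpha',\lambda_u)$: $|x_1-x_1'|\le\alpha|y_1-y_1'|$ implies $|x_2-x_2'|\le\alpha'|y_2-y_2'|$ and $|y_1-y_1'|\le\lambda_u|y_2-y_2'|$. (B)$(\beta;\beta',\lambda_s)$: $|y_2-y_2'|\le\beta|x_2-x_2'|$ implies $|y_1-y_1'|\le\beta'|x_1-x_1'|$ and $|x_2-x_2'|\le\lambda_s|x_1-x_1'|$. (A$'$)$(\alpha,\lambda_u)$: $\sup_x\operatorname{Lip}F_m(x,\cdot)\le\alpha$, $\sup_x\operatorname{Lip}G_m(x,\cdot)\le\lambda_u$. Setting: $X,Y$ are bundles with metric fibers over $M$, $H\sim(F,G)$ a bundle correspondence over $u$, $i=(i_X,i_Y)$ an invariant section: $F_m(i_X(m),i_Y(u(m)))=i_X(u(m))$, $G_m(i_X(m),i_Y(u(m)))=i_Y(m)$. Either (I) $H$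 satisfies (A$'$)$(\alpha,\lambda_u)$ (B)$(\beta;\beta',\lambda_s)$ with $\sup_m\alpha(m)\beta'(u(m))<1$, $\beta'(u(m))\le\beta(m)$, and then $\vartheta(m)=(1-\alpha(m)\beta'(u(m)))^{-1}$; or (II) $H$ satisfies (A)$(\alpha;\alpha',\lambda_u)$ (B)$(\beta;\beta',\lambda_s)$ with $\sup_m\alpha'(m)\beta'(u(m))<1$, $\alpha'(m)\le\alpha(u(m))$, $\beta'(u(m))\le\beta(m)$, and then $\vartheta\equiv1$. All functions $\alpha,\alpha',\beta,\beta',\lambda_s,\lambda_u:M\to\mathbb R_+$ are bounded and $\sup_m\vartheta(m)\lambda_s(m)\lambda_u(m)<1$. Then there is a unique bundle map $f$ (maps $f_m:X_m\to Y_m$) with $\operatorname{Lip}f_m\le\beta'(m)$, $f_m(i_X(m))=i_Y(m)$, and for which there are $x_m:X_m\to X_{u(m)}$, $\operatorname{Lip}x_m\le\lambda_s(m)$, with $F_m(x,f_{u(m)}(x_m(x)))=x_m(x)$, $G_m(x,f_{u(m)}(x_m(x)))=f_m(x)$; this $f$ and these $x_m$ are meant. Spectral notation: for $g:M\to\mathbb R_+$, ''$g<1$'' means $\sup_m\vartheta(m)g(m)<1$. $g^{(n)}(m)=g(u^{n-1}(m))\cdots g(m)$; $g^*(m)=\lim_{n\to\infty}\big(\sup_{N\ge0}g^{(n)}(u^N(m))\big)^{1/n}$ (sup Lyapunov number); $g\in\mathcal E(u)$ means $\lim_n(g^{(n)}(m))^{1/n}$ exists for every $m$. With $\lambda=\lambda_s^\gamma$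 and $g=\lambda_s\lambda_u$, ''$\lambda_s^{*\gamma\theta}\lambda_s\lambda_u<1$'' means: if the maps $x_m(\cdot)$ are bounded uniformly for $m\in M$, or if $\vartheta g\in\mathcal E(u)$, or if $\theta=1$, then $\sup_m\lambda^\theta(m)\vartheta(m)g(m)<1$ or $\sup_m(\lambda^\theta\vartheta g)^*(m)<1$; otherwise $\sup_m(\lambda^*(m))^\theta(\vartheta g)^*(m)<1$.
   Formalization: C is independent of m only if sup_m of λ_s^{γθ}ϑλ_sλ_u is < 1, or its Lyapunov growth is ≤ r < 1 from a rank n not depending on m; otherwise C is uniform only along each forward orbit of u. Without this the claim fails: sup_m(·)^*(m) < 1 gives no bound uniform in m. *)

(* Defs.v *)
From HB Require Import structures.
From mathcomp Require Import all_boot all_order all_algebra.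
From mathcomp Require Import all_classical all_reals all_analysis.
Set Implicit Arguments.
Unset Strict Implicit.
Unset Printing Implicit Defensive.
Import Order.TTheory GRing.Theory Num.Theory.
Import numFieldNormedType.Exports.
Local Open Scope classical_set_scope.
Local Open Scope ring_scope.

Section C1.
Context {R : realType} {V W : normedModType R}.
Implicit Types (L : V -> W) (h : V -> W).

(* Extended-real valued, so that unbounded maps have norm +oo. *)
Definition opnorm L : \bar R :=
  ereal_sup [set `|L v|%:E | v in [set v : V | `|v| <= 1]].

Definition C1 h :=
  (forall z, differentiable h z) /\
  (forall z, opnorm ('d h z' \- 'd h z) @[z' --> z] --> 0%E).

Definition holder_diff (C a : R) h := forall z1 z2 : V,
  (opnorm ('d h z1 \- 'd h z2)%R <= (C * `|z1 - z2| `^ a)%:E)%E.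

End C1.

Section Functions.
Context {R : realType} {M : Type}.
Implicit Types (u : M -> M) (g h lam th : M -> R).

Definition nonneg_bounded g :=
  (forall m, 0 <= g m) /\ exists B, forall m, g m <= B.

(* sup_m h m < 1 *)
Definition sup_lt1 h := (ereal_sup [set (h m)%:E | m in [set: M]] < 1)%E.

(* g^(n) (m) = g (u^(n-1) m) ... g (u m) * g m *)
Definition cocycle u g (n : nat) (m : M) : R := \prod_(k < n) g (iter k u m).

(* For bounded g >= 0 the set is bounded and non-empty, so that [sup] is the
   genuine supremum. *)
Definition orbit_growth u g (n : nat) (m : M) : R :=
  (sup [set cocycle u g n (iter N u m) | N in [set: nat]]) `^ (n%:R^-1).

(* the sup Lyapunov number g^* *)
Definition sup_lyapunov u g (m : M) : R :=
  lim (orbit_growth u g n m @[n --> \oo]).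

(* the class E(u) *)
Definition exact_lyapunov u g := forall m : M,
  cvg ((cocycle u g n m) `^ (n%:R^-1) @[n --> \oo]).

(* "sup_m g^*(m) < 1, with a rank n0 independent of m". Without uniformity,
   sup_m g^*(m) < 1 gives no control of the cocycle that is independent of m:
   on M = nat * nat with u (k, n) = (k, n.+1), the function g (k, n) equal to 2
   if n < k and to 0 otherwise has g^* = 0 but cocycle u g k (k, 0) = 2 ^ k. *)
Definition uniform_lyapunov_lt1 u g := exists2 r : R, r < 1 &
  \forall n \near \oo, forall m, orbit_growth u g n m <= r.

(* The abbreviation "lam^{* theta} g < 1". *)
Definition spectral_lt1 u th (unif_bounded : Prop) lam (theta : R) g :=
  let thg m := th m * g m in
  let P := [\/ unif_bounded, exact_lyapunov u thg | theta = 1] in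
  (P -> sup_lt1 (fun m => lam m `^ theta * thg m) \/
        sup_lt1 (sup_lyapunov u (fun m => lam m `^ theta * thg m))) /\
  (~ P -> sup_lt1 (fun m => sup_lyapunov u lam m `^ theta *
                            sup_lyapunov u thg m)).

End Functions.

Section Correspondence.
Context {R : realType} {M : Type} (u : M -> M).
Context (X Y : M -> normedModType R).
Context (F : forall m, X m * Y (u m) -> X (u m)).
Context (G : forall m, X m * Y (u m) -> Y m).
Implicit Types (m : M) (a b ls lu th : M -> R).

Definition corr m (p1 : X m * Y m) (p2 : X (u m) * Y (u m)) :=
  p1.2 = G (p1.1, p2.2) /\ p2.1 = F (p1.1, p2.2).

(* [condA a a' lu m] is condition (A)(a; a', lu) for H_m. *)
Definition condA a (a' : M -> R) lu m := forall (x1 x1' : X m) (y1 y1' : Y m)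
    (x2 x2' : X (u m)) (y2 y2' : Y (u m)),
  corr (x1, y1) (x2, y2) -> corr (x1', y1') (x2', y2') ->
  `|x1 - x1'| <= a m * `|y1 - y1'| ->
  `|x2 - x2'| <= a' m * `|y2 - y2'| /\ `|y1 - y1'| <= lu m * `|y2 - y2'|.

Definition condB b (b' : M -> R) ls m := forall (x1 x1' : X m) (y1 y1' : Y m)
    (x2 x2' : X (u m)) (y2 y2' : Y (u m)),
  corr (x1, y1) (x2, y2) -> corr (x1', y1') (x2', y2') ->
  `|y2 - y2'| <= b m * `|x2 - x2'| ->
  `|y1 - y1'| <= b' m * `|x1 - x1'| /\ `|x2 - x2'| <= ls m * `|x1 - x1'|.

Definition condA' a lu m := forall x : X m,
  (a m).-lipschitz (fun y => F (x, y)) /\ (lu m).-lipschitz (fun y => G (x, y)).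

Definition caseI a b (b' : M -> R) ls lu th :=
  [/\ nonneg_bounded a, forall m, condA' a lu m /\ condB b b' ls m,
      sup_lt1 (fun m => a m * b' (u m)), forall m, b' (u m) <= b m
    & forall m, th m = (1 - a m * b' (u m))^-1].

Definition caseII a (a' : M -> R) b (b' : M -> R) ls lu th :=
  [/\ nonneg_bounded a /\ nonneg_bounded a',
      forall m, condA a a' lu m /\ condB b b' ls m,
      sup_lt1 (fun m => a' m * b' (u m)),
      forall m, a' m <= a (u m) /\ b' (u m) <= b m
    & forall m, th m = 1].

Definition invariant_section (iX : forall m, X m) (iY : forall m, Y m) :=
  forall m, F (iX m, iY (u m)) = iX (u m) /\ G (iX m, iY (u m)) = iY m.

(* The defining properties of the (unique) invariant bundle map f and of the
   associated maps x_m, here written [xi m]. *)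
Definition invariant_graph (b' : M -> R) ls
    (iX : forall m, X m) (iY : forall m, Y m)
    (f : forall m, X m -> Y m) (xi : forall m, X m -> X (u m)) :=
  forall m,
    [/\ (b' m).-lipschitz (f m), f m (iX m) = iY m, (ls m).-lipschitz (xi m)
      & forall x, F (x, f (u m) (xi m x)) = xi m x /\
                  G (x, f (u m) (xi m x)) = f m x].

End Correspondence.

(* Main.v *)
Require Import Defs.
From HB Require Import structures.
From mathcomp Require Import all_boot all_order all_algebra.
From mathcomp Require Import all_classical all_reals all_analysis.
From mathcomp Require Import ring lra.
Set Implicit Arguments.
Unset Strict Implicit.
Unset Printing Implicit Defensive.
Import Order.TTheory GRing.Theory Num.Theory.
Import numFieldNormedType.Exports.
Local Open Scope classical_set_scope.
Local Open Scope ring_scope.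

(* The whole argument is on mixed second differences of [f]: once
     |f(x+p+q) - f(x+p) - f(x+q) + f(x)| <= C |p| |q|^alpha
   with alpha = gamma theta, the dyadic difference quotients of [f] are Cauchy,
   their limits are additive and bounded, hence linear, and the same bound says
   that the resulting derivative is alpha-Hoelder. To bound the second
   difference at [m], complete the parallelogram on three points of the graph of
   [f m] and follow its fourth vertex through the correspondence: up to second
   differences of [F] and [G], of order |p| |q|^alpha, it is sent to the fourth
   vertex of the parallelogram on the images of the three points, whose sides
   are shorter by the factor [ls m]. The vertical distance from a point to the
   graph over [u m] is multiplied by at most [th m * lu m] on the way back to
   [m]. Iterating gives a sum of the cocycle of ls^alpha * th * ls * lu, plus a
   remainder of order |p| times the cocycle of th * ls * lu, which vanishes. *)

(** * Mean value inequality, and second differences of maps with a Hölder derivative *)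

Section MeanValue.
Context {R : realType}.

(* Minimising [|phi t - phi 0| - K t], with [K] the slope of the chord, gives a
   point [c < 1] to the right of which the slope of [phi] is at least [K]. *)
Lemma mean_value_slope {W : normedModType R} (phi : R -> W) (K : R) :
  (forall t, derivable phi t 1) -> (forall t, `|'D_1 phi t| <= K) ->
  `|phi 1 - phi 0| <= K.
Proof.
move=> dphi bphi; rewrite leNgt; apply/negP => Klt.
set K1 := `|phi 1 - phi 0| in Klt.
pose psi (t : R) : R := `|phi t - phi 0| - K1 * t.
have cphi t : {for t, continuous phi}.
  by apply/differentiable_continuous/derivable1_diffP.
have cpsi : continuous psi.
  move=> t; apply: cvgB.
    by apply: cvg_norm; apply: cvgB; [exact: cphi | exact: cvg_cst].
  by apply: cvgM; [exact: cvg_cst | exact: cvg_id].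
have [c cin cmin] := EVT_min ler01 (continuous_subspaceT cpsi).
have psi0 : psi 0 = 0 by rewrite /psi subrr normr0 mulr0 subrr.
have psi1 : psi 1 = 0 by rewrite /psi mulr1 subrr.
have {c cin cmin} [c /andP[c0 c1] cmin] : exists2 c, 0 <= c < 1 &
    forall t, 0 <= t <= 1 -> psi c <= psi t.
  move: cin; rewrite in_itv /= => /andP[c0]; rewrite le_eqVlt => /orP[/eqP c1|c1].
    exists 0 => [|t t01]; first by rewrite lexx ltr01.
    by rewrite psi0 -psi1 -c1; apply: cmin; rewrite in_itv.
  by exists c => [|t t01]; [rewrite c0 c1|apply: cmin; rewrite in_itv].
have /cvgr_norm_lt near_lt := cvg_dnbhs_at_right (dphi c).
have {}near_lt := near_lt K1 (le_lt_trans (bphi c) Klt).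
have lt1 : \forall h \near (0:R)^'+, h < 1 - c.
  by apply: nbhs_right_lt; rewrite subr_gt0.
have [h [h0 h1 hlt]] : exists h : R, [/\ 0 < h, h < 1 - c &
    `|h^-1 *: (phi (h + c) - phi c)| < K1].
  apply: (@filter_ex _ (0:R)^'+); near=> h; split.
  - by near: h; exact: nbhs_right_gt.
  - by near: h.
  - by near: h; apply: filterS near_lt => h; rewrite /= /shift /= scaler1.
have := cmin (h + c); rewrite addr_ge0 ?(ltW h0)//= -lerBrDr (ltW h1) => /(_ isT).
rewrite /psi mulrDr -subr_ge0.
move: hlt; rewrite normrZ normfV (gtr0_norm h0) ltr_pdivrMl// => hlt.
have := ler_distD (phi c) (phi (h + c)) (phi 0).
by move=> *; nra.
Unshelve. all: by end_near. Qed.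

Lemma mean_value_le {V W : normedModType R} (g : V -> W) (z v : V) (K : R) :
  (forall y, differentiable g y) -> (forall y, `|'d g y v| <= K) ->
  `|g (z + v) - g z| <= K.
Proof.
move=> dg bg; pose phi (t : R) := g (z + t *: v).
have isd (t : R) : is_derive t (1 : R) phi ('d g (z + t *: v) v).
  have : is_derive (z + t *: v) v g ('d g (z + t *: v) v).
    by rewrite -deriveE//; apply/derivableP/diff_derivable.
  (* The quotients of [phi] at [t] and of [g] at [z + t v] along [v] are the same function of [h],
     so the derivative carries over. *)
  have e : (fun h : R => h^-1 *: ((phi \o shift t) (h *: 1) - phi t)) =
    (fun h : R => h^-1 *: ((g \o shift (z + t *: v)) (h *: v) - g (z + t *: v))).
    apply/funext => h /=; congr (_ *: (g _ - _)).
    by rewrite scaler1 scalerDl addrCA.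
  by case=> d1 d2; split; rewrite /derivable /derive e.
have := @mean_value_slope W phi K (fun t => @ex_derive _ _ _ _ _ _ _ (isd t)) _.
rewrite /phi scale1r scale0r addr0; apply=> t.
by rewrite derive_val.
Qed.

Lemma holder_diff_le {V W : normedModType R} (C a : R) (h : V -> W) :
  holder_diff C a h -> forall z1 z2 v,
  `|'d h z1 v - 'd h z2 v| <= C * `|z1 - z2| `^ a * `|v|.
Proof.
move=> hh z1 z2 v; have [->|v0] := eqVneq v 0.
  by rewrite normr0 mulr0 (linear0 ('d h z1)) (linear0 ('d h z2)) subrr normr0.
have nv : 0 < `|v| by rewrite normr_gt0.
set w := `|v|^-1 *: v.
have -> : 'd h z1 v - 'd h z2 v = `|v| *: ('d h z1 w - 'd h z2 w).
  rewrite (linearZZ ('d h z1)) (linearZZ ('d h z2)) -scalerBr scalerA.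
  by rewrite mulfV ?gt_eqF// scale1r.
rewrite normrZ normr_id mulrC ler_wpM2r// -lee_fin.
apply: le_trans (hh z1 z2); apply: ereal_sup_ubound => /=.
by exists w => //=; rewrite normrZ normfV normr_id mulVf ?gt_eqF.
Qed.

(** The second difference is the increment over [p] of [g y = h (y + q) - h y], and the differential
    of [g] is a difference of differentials of [h] at points [q] apart; the mean value inequality
    applies to [g]. *)
Lemma second_difference_le {V W : normedModType R} (C a : R) (h : V -> W) :
  C1 h -> holder_diff C a h -> forall z p q,
  `|h (z + p + q) - h (z + p) - h (z + q) + h z| <= C * `|q| `^ a * `|p|.
Proof.
move=> [dh _] hh z p q; pose g y := h (y + q) - h y.
have dshift y : is_diff y (fun y => h (y + q)) ('d h (y + q)).
  have Hq : is_diff y (fun y : V => y + q) id.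
    have := is_diffD (is_diff_id y) (is_diff_cst q y).
    by rewrite addr0.
  have Hh : is_diff (y + q) h ('d h (y + q)) by apply: differentiableP.
  exact: (is_diff_comp Hq Hh).
have isg y : is_diff y g (fun v => 'd h (y + q) v - 'd h y v).
    have Hh : is_diff y h ('d h y) by apply: differentiableP.
    exact: is_diffB (dshift y) Hh.
have -> : h (z + p + q) - h (z + p) - h (z + q) + h z = g (z + p) - g z.
  by rewrite /g opprB !addrA addrAC.
apply: mean_value_le => y; first exact: ex_diff.
rewrite diff_val /=.
by apply: le_trans (holder_diff_le hh _ _ _) _; rewrite addrC addKr.
Qed.

End MeanValue.

(** * From bounds on second differences to a Hölder derivative *)

Section SecondDifference.
Context {R : realType}.

(** The distance from the first term to the limit matters as much as convergence: for dyadic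
    quotients it is the first-order Taylor remainder. *)
Lemma geometric_steps_cvg {W : completeNormedModType R} (u : nat -> W)
    (K r : R) :
  0 <= r < 1 -> (forall k, `|u k.+1 - u k| <= K * r ^+ k) ->
  exists2 l, u n @[n --> \oo] --> l & `|u 0 - l| <= K / (1 - r).
Proof.
move=> /andP[r0 r1] hu; have r1' : 0 < 1 - r by rewrite subr_gt0.
have K0 : 0 <= K by have := hu 0; rewrite expr0 mulr1; apply: le_trans.
have tail n k : `|u (n + k)%N - u n| <= K / (1 - r) * (r ^+ n - r ^+ (n + k)).
  elim: k => [|k IH]; first by rewrite addn0 !subrr normr0 mulr0.
  rewrite -(subrK (u (n + k)%N) (u (n + k.+1)%N)) -addrA.
  rewrite (le_trans (ler_normD _ _))// addnS.
  rewrite (le_trans (lerD (hu _) IH))//.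
  rewrite exprS le_eqVlt; apply/orP; left; apply/eqP; field.
  by rewrite gt_eqF.
have tail' n k : `|u (n + k)%N - u n| <= K / (1 - r) * r ^+ n.
  apply: le_trans (tail n k) _; apply: ler_wpM2l; first by rewrite divr_ge0// ltW.
  by rewrite gerBl exprn_ge0.
have ucvg : cvg (u n @[n --> \oo]).
  apply/cauchy_cvgP/cauchy_exP => _/posnumP[e].
  have : K / (1 - r) * r ^+ n @[n --> \oo] --> 0.
    rewrite -(mulr0 (K / (1 - r))); apply: cvgM; first exact: cvg_cst.
    by apply: cvg_expr; rewrite ger0_norm.
  move=> /cvgr_norm_lt /(_ e%:num); rewrite normr0 => /(_ _)[]// n _ /(_ n) /=.
  move=> /(_ (leqnn n)) hn.
  exists (u n); exists n => // k /= nk; rewrite -ball_normE /= distrC.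
  rewrite -(subnKC nk); apply: le_lt_trans hn.
  by apply: le_trans (tail' n (k - n)%N) _; rewrite ler_norm.
exists (lim (u n @[n --> \oo])) => //.
have : `|u 0 - u n| @[n --> \oo] --> `|u 0 - lim (u n @[n --> \oo])|.
  by apply: cvg_norm; apply: cvgB => //; exact: cvg_cst.
move=> /ler_cvg_to; apply; first exact: cvg_cst.
by near=> n; have := tail' 0 n; rewrite expr0 mulr1 distrC.
Unshelve. all: by end_near. Qed.

(* [D (t v) - t D v] is additive and bounded in [t], and vanishes for [t] an
   integer. *)
Lemma additive_bounded_scalable {V W : normedModType R} (D : V -> W) (L : R) :
  (forall p q, D (p + q) = D p + D q) -> (forall v, `|D v| <= L * `|v|) ->
  forall (t : R) v, D (t *: v) = t *: D v.
Proof.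
move=> DD Db t v; pose e (s : R) := D (s *: v) - s *: D v.
have eD s s' : e (s + s') = e s + e s'.
  by rewrite /e !scalerDl DD opprD addrACA.
have e0 : e 0 = 0.
  have /eqP := eD 0 0.
  by rewrite addr0 -subr_eq0 opprD addrA subrr sub0r oppr_eq0 => /eqP.
have eN s : e (- s) = - e s.
  by apply/eqP; rewrite -addr_eq0 -eD addNr e0.
have eMn s n : e (s *+ n) = e s *+ n.
  by elim: n => [|n IH]; rewrite ?mulr0n// !mulrSr eD IH.
have e1 : e 1 = 0 by rewrite /e !scale1r subrr.
have ez (z : int) : e z%:~R = 0.
  case: z => n; first by rewrite -pmulrn eMn e1 mul0rn.
  by rewrite NegzE mulrNz -pmulrn eN eMn e1 mul0rn oppr0.
have B0 : 0 <= L * `|v| by apply: le_trans (Db v).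
have eb s : `|e s| <= (L * `|v|) *+ 2.
  have -> : e s = e (s - (Num.floor s)%:~R) by rewrite eD eN ez subr0.
  have /andP[] := floor_itv s; set r := s - _; rewrite -subr_ge0 -/r => r0.
  rewrite intrD -ltrBlDl -/r => r1.
  rewrite /e mulr2n (le_trans (ler_normB _ _))// !normrZ ger0_norm// lerD//.
    apply: le_trans (Db _) _; rewrite normrZ ger0_norm// mulrCA.
    by rewrite ler_piMl// ltW.
  by apply: le_trans (Db v); rewrite ler_piMl// ltW.
apply/eqP; rewrite -subr_eq0 -normr_le0 -/(e t) leNgt; apply/negP => et0.
have B1 : 0 <= (L * `|v|) *+ 2 / `|e t| by rewrite divr_ge0 ?mulrn_wge0.
have := archi_boundP B1; rewrite ltr_pdivrMr// mulr_natl -normrMn -eMn.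
by rewrite ltNge eb.
Qed.

Lemma is_diff_holder {V W : normedModType R} (f : V -> W) (x : V)
    (D : V -> W) (L C a : R) :
  0 < a -> linear D -> (forall v, `|D v| <= L * `|v|) ->
  (forall v, `|f (x + v) - f x - D v| <= C * `|v| `^ a * `|v|) ->
  is_diff x f D.
Proof.
move=> a0 lD Db fD.
pose Dm := GRing.isLinear.Build R V W *:%R D lD.
pose Dl : {linear V -> W} := HB.pack D Dm.
have Dc : continuous Dl.
  apply/linear_bounded_continuous; exists `|L|; split; first exact: num_real.
  move=> M LM; near=> y.
  apply: (le_trans (Db y)); rewrite (le_trans (ler_norm _))// normrM normr_id.
  rewrite -[leRHS]mulr1; apply: ler_pM => //; first exact: ltW.
have C1 : 0 < `|C| + 1 by rewrite ltr_wpDl.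
have fexp : f \o shift x = cst (f x) + Dl +o_ (0 : V) id.
  apply/eqaddoP => _/posnumP[e].
  (* [|C| + 1] stands in for [C], whose sign is not known here; the bound by [e] then amounts to
     [|v|] being at most [q] to the power [a^-1]. *)
  pose q := e%:num / (`|C| + 1); have q0 : 0 < q by apply: divr_gt0.
  near=> v => /=.
  have -> : (f \o shift x - (cst (f x) + (Dl : V -> W))) v =
            f (x + v) - f x - D v.
    by rewrite !fctE /= opprD addrA [v + x]addrC.
  apply: le_trans (fD v) _; rewrite ler_wpM2r// (le_trans (ler_norm _))//.
  rewrite normrM [X in _ * X]ger0_norm ?powR_ge0//.
  apply: (@le_trans _ _ ((`|C| + 1) * `|v| `^ a)).
    by rewrite ler_wpM2r ?powR_ge0// lerDl.
  rewrite mulrC -ler_pdivlMr// -/q.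
  rewrite -[leRHS](powRr1 (ltW q0)) -(mulVf (lt0r_neq0 a0)) powRrM.
  apply: ge0_ler_powR; rewrite ?nnegrE ?powR_ge0 ?(ltW a0)//.
  by near: v; apply: nbhs0_le; apply: powR_gt0.
have d := diff_unique Dc fexp; split=> //; apply/diff_locallyP; rewrite d.
by split; first exact: Dc.
Unshelve. all: by end_near. Qed.

Lemma powR_expr (x a : R) k : 0 <= x -> (x ^+ k) `^ a = (x `^ a) ^+ k.
Proof.
by move=> x0; elim: k => [|k IH]; rewrite ?expr0 ?powR1// !exprS powRM ?exprn_ge0// IH.
Qed.

Lemma second_difference_C1 {V : normedModType R} {W : completeNormedModType R}
    (f : V -> W) (L C a : R) :
  0 < a -> 0 <= C -> (forall x p, `|f (x + p) - f x| <= L * `|p|) ->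
  (forall x p q,
     `|f (x + p + q) - f (x + p) - f (x + q) + f x| <= C * `|q| `^ a * `|p|) ->
  C1 f /\ holder_diff C a f.
Proof.
move=> a0 C0 fL fQ; pose s (k : nat) : R := 2^-1 ^+ k; pose r : R := 2^-1 `^ a.
have s0 k : 0 < s k by rewrite exprn_gt0// invr_gt0.
have ns k (v : V) : `|s k *: v| = s k * `|v| by rewrite normrZ gtr0_norm.
have sV k : (2 ^+ k) * s k = 1 by rewrite -exprMn mulfV// expr1n.
have r1 : 0 <= r < 1.
  have a1 : 1 `^ a = 1 :> R by rewrite powR1.
  rewrite powR_ge0/= /r -[ltRHS]a1.
  by apply: gt0_ltr_powR; rewrite ?nnegrE ?invr_ge0// invf_lt1// ltr1n.
have sa k : s k `^ a = r ^+ k by rewrite powR_expr// invr_ge0.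
have Q2 k x p q : `|2 ^+ k *: (f (x + s k *: p + q) - f (x + s k *: p) -
    f (x + q) + f x)| <= C * `|q| `^ a * `|p|.
  rewrite normrZ ger0_norm ?exprn_ge0//.
  apply: le_trans (ler_wpM2l _ (fQ _ _ _)) _; first by rewrite exprn_ge0.
  by rewrite ns mulrCA [_ * (s k * _)]mulrA sV mul1r.
pose u x v k := 2 ^+ k *: (f (x + s k *: v) - f x).
have ustep x v k : `|u x v k.+1 - u x v k| <= C * `|v| `^ a * `|v| * r ^+ k.
  pose w := s k.+1 *: v; have sw : s k *: v = w + w.
    by rewrite -mulr2n -scaler_nat scalerA /s exprS mulrA mulfV// mul1r.
  (* Since [s k *: v] is [w + w], one halving of the step is a second difference with both sides
     equal to [w]. *)
  have -> : u x v k.+1 - u x v k = - (2 ^+ k *: (f (x + s k.+1 *: v + w) -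
      f (x + s k.+1 *: v) - f (x + w) + f x)).
    rewrite /u sw -/w exprS [2 * _]mulrC -scalerA -scalerBr -scalerN !addrA.
    congr (_ *: _); rewrite scaler_nat mulr2n; set A := f (x + w).
    set B := f (x + w + w); set F := f x.
    by rewrite [- (B - F)]opprB -addrA subrKA opprD !opprB addrAC.
  rewrite normrN normrZ ger0_norm ?exprn_ge0//.
  apply: le_trans (_ : C * `|w| `^ a * `|v| <= _).
    apply: le_trans (Q2 k.+1 x v w); rewrite normrZ ger0_norm ?exprn_ge0//.
    by rewrite ler_wpM2r// ler_weXn2l// ler1n.
  rewrite ns powRM ?(ltW (s0 _))// sa [leRHS]mulrAC ler_wpM2r// -mulrA.
  rewrite ler_wpM2l// mulrC ler_wpM2l ?powR_ge0//.
  by rewrite ler_wiXn2l// ?(andP r1).1// ltW// (andP r1).2.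
have [D HD] : exists D : V -> V -> W, forall x v,
    u x v k @[k --> \oo] --> D x v /\
    `|u x v 0 - D x v| <= C * `|v| `^ a * `|v| / (1 - r).
  have H (xv : V * V) : exists l, u xv.1 xv.2 k @[k --> \oo] --> l /\
      `|u xv.1 xv.2 0 - l| <= C * `|xv.2| `^ a * `|xv.2| / (1 - r).
    have [l l1 l2] := geometric_steps_cvg r1 (ustep xv.1 xv.2).
    by exists l.
  have [D HD] := choice H.
  by exists (fun x v => D (x, v)) => x v; have := HD (x, v).
have Dcvg x v := (HD x v).1.
have DL x v : `|D x v| <= L * `|v|.
  have /cvg_norm /ler_cvg_to := Dcvg x v; apply; first exact: cvg_cst.
  near=> k; rewrite /u normrZ ger0_norm ?exprn_ge0//.
  apply: le_trans (ler_wpM2l _ (fL _ _)) _; first by rewrite exprn_ge0.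
  by rewrite ns mulrCA [_ * (s k * _)]mulrA sV mul1r.
have DD x p q : D x (p + q) = D x p + D x q.
  apply/eqP; rewrite -subr_eq0 opprD addrA -normr_le0.
  have r0 : C * `|q| `^ a * `|p| * r ^+ k @[k --> \oo] --> 0.
    rewrite -(mulr0 (C * `|q| `^ a * `|p|)); apply: cvgM; first exact: cvg_cst.
    by apply: cvg_expr; case/andP: r1 => ? ?; rewrite ger0_norm.
  apply: ler_cvg_to
    (cvg_norm (cvgB (cvgB (Dcvg x (p + q)) (Dcvg x p)) (Dcvg x q))) r0 _.
  (* The additivity defect at rank [k] is [2 ^+ k] times a second difference with sides [s k *: p]
     and [s k *: q]; the power [a] of the second side supplies the vanishing factor [r ^+ k]. *)
  near=> k; rewrite !fctE.
  have -> : u x (p + q) k - u x p k - u x q k =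
    2 ^+ k *: (f (x + s k *: p + s k *: q) - f (x + s k *: p) -
      f (x + s k *: q) + f x).
    rewrite /u -!scalerBr; congr (_ *: _); rewrite scalerDr addrA.
    by rewrite !opprB subrKA [f x - _]addrC !addrA.
  apply: le_trans (Q2 _ _ _ _) _.
  by rewrite ns powRM ?(ltW (s0 _))// sa [r ^+ k * _]mulrC mulrA mulrAC.
have Dlin x : linear (D x).
  move=> t p q; rewrite DD; congr (_ + _).
  exact: (additive_bounded_scalable (DD x) (DL x)).
have dD x : is_diff x f (D x).
  apply: (@is_diff_holder _ _ _ _ _ L (C / (1 - r)) a) => // v.
  have := (HD x v).2; rewrite /u expr0 scale1r /s expr0 scale1r.
  by rewrite mulrAC [_ * _ / _]mulrAC.
(* The quotients at [z1] and [z2] differ by [2 ^+ k] times a second difference with sides [s k *: v]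
   and [z1 - z2], so the Hölder constant is [C] itself and not the [C / (1 - r)] of the Taylor
   remainder. *)
have hold z1 z2 v : `|D z1 v - D z2 v| <= C * `|z1 - z2| `^ a * `|v|.
  apply: ler_cvg_to (cvg_norm (cvgB (Dcvg z1 v) (Dcvg z2 v))) (@cvg_cst _ _ _ _ _) _.
  near=> k; rewrite !fctE.
  have -> : u z1 v k - u z2 v k = 2 ^+ k *: (f (z2 + s k *: v + (z1 - z2)) -
      f (z2 + s k *: v) - f (z2 + (z1 - z2)) + f z2).
    rewrite /u -scalerBr; congr (_ *: _).
    have e : z2 + (z1 - z2) = z1 by rewrite addrC subrK.
    by rewrite [z2 + _ + _]addrAC e opprD opprK addrA [_ - f z1 - _]addrAC.
  exact: Q2.
have hf : holder_diff C a f.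
  move=> z1 z2; apply: ge_ereal_sup => _ [v /= v1 <-].
  rewrite lee_fin !diff_val; apply: le_trans (hold _ _ _) _.
  by rewrite ler_piMr// mulr_ge0// powR_ge0.
split=> //; split=> [z|z]; first exact: ex_diff.
have powR0 : `|z' - z| `^ a @[z' --> z] --> (0 : R).
  apply/cvgrPdist_le => e e0; near=> z'.
  rewrite sub0r normrN ger0_norm ?powR_ge0//.
  rewrite -[leRHS](powRr1 (ltW e0)) -(mulVf (lt0r_neq0 a0)) powRrM.
  apply: ge0_ler_powR; rewrite ?nnegrE ?powR_ge0 ?(ltW a0)//.
  rewrite distrC; near: z'.
  have /cvgrPdist_le : z' @[z' --> z] --> z by exact: cvg_id.
  by apply; exact: powR_gt0.
apply: (@squeeze_cvge _ _ _ _ (cst 0%E) _ (fun z' => (C * `|z' - z| `^ a)%:E)).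
- near=> z'; rewrite hf andbT; apply: ereal_sup_ubound => /=.
  exists 0; first by rewrite normr0.
  by rewrite (linear0 ('d f z')) (linear0 ('d f z)) subrr normr0.
- exact: cvg_cst.
- apply: cvg_EFin; first by near=> z'.
  by rewrite -(mulr0 C); apply: cvgM; first exact: cvg_cst.
Unshelve. all: by end_near. Qed.

End SecondDifference.

(** * Vertical distance to a Lipschitz graph, tested inside cones *)

Section Cones.
Context {R : realType} {V W : normedModType R}.
Implicit Types (f : V -> W) (b c e r s t : R).

Lemma lipschitz_le f b : b.-lipschitz f ->
  forall x x', `|f x - f x'| <= b * `|x - x'|.
Proof. by move=> fb x x'; exact: (fb (x, x')). Qed.

(* Only the graph points in a cone with apex [p] are tested: in case (II),
   condition (A) gives no information on the others. *)
Definition near_graph f c t (p : V * W) := forall x' : V,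
  `|p.1 - x'| <= c * `|p.2 - f x'| -> `|p.2 - f x'| <= t.

Lemma near_graph_le f c t t' p : t <= t' -> near_graph f c t p -> near_graph f c t' p.
Proof. by move=> tt' H x' /H /le_trans; apply. Qed.

Lemma move_toward (x x' : V) s : 0 <= s ->
  exists2 x'', `|x'' - x'| <= s & `|x - x''| <= Num.max 0 (`|x - x'| - s).
Proof.
move=> s0; have [ds|sd] := leP `|x - x'| s.
  by exists x => //; rewrite subrr normr0 le_max lexx.
have d0 : 0 < `|x - x'| by apply: le_lt_trans sd.
exists (x' + (s / `|x - x'|) *: (x - x')).
  rewrite addrAC subrr add0r normrZ ger0_norm ?divr_ge0// mulfVK//.
  by rewrite gt_eqF.
rewrite opprD addrA -{1}[x - x']scale1r -scalerBl normrZ ger0_norm.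
  by rewrite mulrBl mul1r mulfVK ?gt_eqF// le_max lexx orbT.
by rewrite subr_ge0 ler_pdivrMr// mul1r ltW.
Qed.

(** A test point [x'] in the cone of the displaced apex may lie outside the original cone; moving it
    by [s] towards [x] brings it inside, and the graph changes by at most [b * s] in between. *)
Lemma near_graph_perturb f b c r t e (x E : V) (y E' : W) :
  (forall x x', `|f x - f x'| <= b * `|x - x'|) ->
  0 <= b -> 0 <= c -> b * c <= r -> r < 1 -> `|E| <= e -> `|E'| <= e ->
  near_graph f c t (x, y) ->
  near_graph f c (t + (1 + b * (1 + c) / (1 - r)) * e) (x + E, y + E').
Proof.
move=> fb b0 c0 bc r1 Ee E'e H x' /= hx'.
have r1' : 0 < 1 - r by rewrite subr_gt0.
have e0 : 0 <= e by apply: le_trans Ee.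
(* The move by [s] must pay for the displacement, [(1 + c) * e], and for its own effect on the cone,
   [c * b * s <= r * s]; this value makes the two add up to [s]. *)
pose s := (1 + c) * e / (1 - r).
have s0 : 0 <= s by apply: divr_ge0; [rewrite mulr_ge0 ?addr_ge0|exact: ltW].
have [x'' x''s x''d] := move_toward x x' s0.
have fx'' : `|f x'' - f x'| <= b * s by apply: le_trans (fb _ _) _; rewrite ler_wpM2l.
have y1 : `|y - f x'| <= `|y - f x''| + b * s.
  rewrite -(subrKA (f x'') y (- f x')); apply: le_trans (ler_normD _ _) _.
  by rewrite lerD2l.
have y2 : `|y + E' - f x'| <= `|y - f x'| + e.
  by rewrite addrAC; apply: le_trans (ler_normD _ _) _; rewrite lerD2l.
have x1 : `|x - x'| <= `|x + E - x'| + e.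
  rewrite -[x - x'](addrK E) [x - x' + E]addrAC.
  by apply: le_trans (ler_normB _ _) _; rewrite lerD2l.
have sr : s * (1 - r) = (1 + c) * e by rewrite /s mulfVK ?gt_eqF.
have : `|y - f x''| <= t.
  apply: H => /=; apply: le_trans x''d _; rewrite ge_max mulr_ge0//=.
  have := ler_wpM2l c0 y1; have := ler_wpM2l c0 y2.
  have := ler_wpM2l s0 bc; lra.
have -> : (1 + b * (1 + c) / (1 - r)) * e = e + b * s.
  by rewrite /s; field; rewrite gt_eqF.
lra.
Qed.

(** A first-order bound, which starts the induction on the number of iterates. With [d] the distance
    to estimate, the Lipschitz bound gives [d <= b * A + b * (A + c * d)], solved for [d] thanks to
    [b * c <= r < 1]. *)
Lemma near_graph_parallelogram f b c r A (x0 x1 x2 : V) :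
  (forall x x', `|f x - f x'| <= b * `|x - x'|) ->
  0 <= b -> 0 <= c -> b * c <= r -> r < 1 -> `|x1 - x0| <= A ->
  near_graph f c (2 * b / (1 - r) * A) (x1 + x2 - x0, f x1 + f x2 - f x0).
Proof.
move=> fb b0 c0 bc r1 x10 x' /= hx'.
have r1' : 0 < 1 - r by rewrite subr_gt0.
set d := `|_ - f x'| in hx' *.
have h1 : `|f x1 - f x0| <= b * A by apply: le_trans (fb _ _) _; rewrite ler_wpM2l.
have h2 : `|f x2 - f x'| <= b * (A + c * d).
  apply: le_trans (fb _ _) _; rewrite ler_wpM2l//.
  have -> : x2 - x' = (x1 + x2 - x0 - x') - (x1 - x0).
    by rewrite opprB [_ - x0 - x']addrAC subrKA -[x1 + x2 - x']addrA [RHS]addrC addKr.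
  by apply: le_trans (ler_normB _ _) _; rewrite addrC lerD.
have h3 : d <= `|f x1 - f x0| + `|f x2 - f x'|.
  apply: le_trans (ler_normD _ _); rewrite /d le_eqVlt; apply/orP; left.
  by rewrite addrACA addrA.
have d0 : 0 <= d by exact: normr_ge0.
rewrite mulrAC ler_pdivlMr//.
have := ler_wpM2r d0 bc; lra.
Qed.
End Cones.

(** The supremum may be negative, or [-oo] when [M] is empty; truncating at 0 gives a ratio usable
    in geometric sums. *)
Lemma sup_lt1_le {R : realType} {M : Type} (h : M -> R) :
  sup_lt1 h -> exists2 r, 0 <= r < 1 & forall m, h m <= r.
Proof.
rewrite /sup_lt1; set S := [set _ | _ in _]; case E : (ereal_sup S) => [r| |] // r1.
  exists (Num.max 0 r) => [|m].
    by rewrite le_max lexx/= gt_max ltr01/= -lte_fin.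
  rewrite le_max -[h m <= r]lee_fin -E; apply/orP; right.
  by apply: ereal_sup_ubound; exists m.
exists 0 => [|m]; first by rewrite lexx ltr01.
have : ((h m)%:E <= ereal_sup S)%E by apply: ereal_sup_ubound; exists m.
by rewrite E.
Qed.

Lemma lipschitz_prod {R : realType} {V W Z : normedModType R} (h : V * W -> Z)
    (k l : R) :
  0 <= k -> 0 <= l ->
  (forall x x' y, `|h (x, y) - h (x', y)| <= k * `|x - x'|) ->
  (forall x y y', `|h (x, y) - h (x, y')| <= l * `|y - y'|) ->
  forall z z', `|h z - h z'| <= (k + l) * `|z - z'|.
Proof.
move=> k0 l0 hk hl [x y] [x' y'].
rewrite -(subrKA (h (x', y)) (h (x, y)) (- _)) mulrDl.
apply: le_trans (ler_normD _ _) _; rewrite prod_normE /=; apply: lerD.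
  by apply: le_trans (hk _ _ _) _; rewrite ler_wpM2l// le_max lexx.
by apply: le_trans (hl _ _ _) _; rewrite ler_wpM2l// le_max lexx orbT.
Qed.

(* The exponent [g] may be lowered to [g * th], because the second difference
   of a Lipschitz map is also at most [2 L |p|]. *)
Lemma second_difference_interp {R : realType} {V W : normedModType R}
    (h : V -> W) (M0 L K g th A B : R) (z p q : V) :
  0 <= M0 -> 0 <= L -> 0 <= K -> 0 < g -> 0 < th <= 1 -> 0 <= A -> 0 <= B ->
  (forall z z', `|h z - h z'| <= L * `|z - z'|) ->
  `|h (z + p + q) - h (z + p) - h (z + q) + h z| <= M0 * `|q| `^ g * `|p| ->
  `|p| <= K * A -> `|q| <= K * B ->
  `|h (z + p + q) - h (z + p) - h (z + q) + h z|
     <= (M0 * K `^ g * K + 2 * L * K) * (A * B `^ (g * th)).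
Proof.
move=> M00 L0 K0 g0 /andP[t0 t1] A0 B0 hL hQ pA qB.
have gt0 : 0 < g * th by rewrite mulr_gt0.
have c1 : 0 <= M0 * K `^ g * K by rewrite !mulr_ge0// powR_ge0.
have c2 : 0 <= 2 * L * K by rewrite !mulr_ge0.
have [B1|B1] := leP B 1.
  have hB : B `^ g <= B `^ (g * th).
    have [->|Bn0] := eqVneq B 0; first by rewrite !powR0 ?gt_eqF.
    by apply: ger_powR; rewrite ?lt0r ?Bn0 ?B0// ler_piMr// ltW.
  rewrite mulrDl -[leLHS]addr0; apply: lerD; last first.
    by rewrite !mulr_ge0// powR_ge0.
  apply: le_trans hQ _.
  have -> : M0 * K `^ g * K * (A * B `^ (g * th)) =
      M0 * (K `^ g * B `^ (g * th)) * (K * A) by ring.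
  apply: ler_pM => //; first by rewrite mulr_ge0// powR_ge0.
  apply: ler_wpM2l => //.
  apply: (@le_trans _ _ ((K * B) `^ g)).
    by apply: ge0_ler_powR; rewrite ?nnegrE ?mulr_ge0// ltW.
  by rewrite powRM// ler_wpM2l// powR_ge0.
have hB : 1 <= B `^ (g * th).
  have {1}-> : 1 = 1 `^ (g * th) :> R by rewrite powR1.
  by apply: ge0_ler_powR; rewrite ?nnegrE// ltW.
rewrite mulrDl -[leLHS]add0r; apply: lerD.
  by rewrite !mulr_ge0// powR_ge0.
have -> : h (z + p + q) - h (z + p) - h (z + q) + h z =
    (h (z + p + q) - h (z + q)) - (h (z + p) - h z).
  by rewrite opprB [h z - _]addrC addrA [_ - h (z + q) - _]addrAC.
apply: le_trans (ler_normB _ _) _.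
have e1 : `|h (z + p + q) - h (z + q)| <= L * (K * A).
  apply: le_trans (hL _ _) _; rewrite ler_wpM2l//.
  by rewrite [z + p + q]addrAC [z + q + p]addrC addrK.
have e2 : `|h (z + p) - h z| <= L * (K * A).
  by apply: le_trans (hL _ _) _; rewrite ler_wpM2l// [z + p]addrC addrK.
apply: le_trans (lerD e1 e2) _.
have -> : L * (K * A) + L * (K * A) = 2 * L * K * A by ring.
by rewrite [leRHS]mulrA ler_peMr// mulr_ge0.
Qed.

(** * Transfer of cones through the correspondence, and the parallelogram estimate *)

Section InvariantGraph.
Context {R : realType} {M : Type} (u : M -> M) (X Y : M -> normedModType R).
Context (F : forall m, X m * Y (u m) -> X (u m)).
Context (G : forall m, X m * Y (u m) -> Y m).
Context (f : forall m, X m -> Y m) (xi : forall m, X m -> X (u m)).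
Context (a a' b b' ls lu th : M -> R).
Arguments F : clear implicits.
Arguments G : clear implicits.
Arguments f : clear implicits.
Arguments xi : clear implicits.
(** Pairs with equal [y2] satisfy the premise of (B), whose conclusion bounds [F] and [G] in the
    first variable. In the second variable the bounds come from (A'), or from (A) at equal [x1]. *)
Lemma generating_map_lipschitz :
  nonneg_bounded b -> nonneg_bounded b' -> nonneg_bounded ls ->
  nonneg_bounded lu ->
  caseI F G a b b' ls lu th \/ caseII F G a a' b b' ls lu th ->
  exists2 L, 0 <= L & forall m,
    (forall z z', `|F m z - F m z'| <= L * `|z - z'|) /\
    (forall z z', `|G m z - G m z'| <= L * `|z - z'|).
Proof.
move=> [b0 _] [b'0 [Bb bB]] [ls0 [Bs sB]] [lu0 [Bu uB]] hcase.
have B m : condB F G b b' ls m by case: hcase => -[_ /(_ m)[]].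
have hx m x x' y : `|F m (x, y) - F m (x', y)| <= ls m * `|x - x'| /\
    `|G m (x, y) - G m (x', y)| <= b' m * `|x - x'|.
  have := B m x x' (G m (x, y)) (G m (x', y)) (F m (x, y)) (F m (x', y)) y y.
  by rewrite subrr normr0 mulr_ge0// => /(_ _ _ isT)[].
(* [0 <= La] is kept under the quantifier over [m] because [M] may be empty; the truncations at 0 in
   the final constant have the same cause. *)
have [La hy] : exists La, forall m x y y', 0 <= La /\
    `|F m (x, y) - F m (x, y')| <= La * `|y - y'| /\
    `|G m (x, y) - G m (x, y')| <= lu m * `|y - y'|.
  case: hcase => [[[a0 [La aL]] AB _ _ _]|[[[a0 _] [a'0 [La aL]]] AB _ _ _]].
    exists La => m x y y'; have [AF AG] := (AB m).1 x; split.
      exact: le_trans (aL m).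
    split; last exact: lipschitz_le AG _ _.
    by apply: le_trans (lipschitz_le AF _ _) _; rewrite ler_wpM2r.
  exists La => m x y y'; split; first exact: le_trans (aL m).
  have := (AB m).1 x x (G m (x, y)) (G m (x, y')) (F m (x, y)) (F m (x, y')) y y'.
  rewrite subrr normr0 mulr_ge0// => /(_ _ _ isT)[]// h1 h2; split=> //.
  by apply: le_trans h1 _; rewrite ler_wpM2r.
exists (Num.max 0 (Bs + La) + Num.max 0 (Bb + Bu)).
  by rewrite addr_ge0// le_max lexx.
move=> m; split=> z z'.
  have La0 : 0 <= La := (hy m z.1 z.2 z.2).1.
  apply: (@le_trans _ _ ((Bs + La) * `|z - z'|)).
    apply: lipschitz_prod => //; first exact: le_trans (sB m).
      by move=> x x' y; apply: le_trans (hx m x x' y).1 _; exact: ler_wpM2r.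
    by move=> x y y'; case: (hy m x y y') => _ [].
  by rewrite ler_wpM2r// ler_wpDr ?le_max ?lexx ?orbT.
have Bu0 : 0 <= Bu by apply: le_trans (uB m).
have Bb0 : 0 <= Bb by apply: le_trans (bB m).
apply: (@le_trans _ _ ((Bb + Bu) * `|z - z'|)).
  apply: lipschitz_prod => // [x x' y|x y y'].
    apply: le_trans (hx m x x' y).2 _; exact: ler_wpM2r.
  apply: le_trans (hy m x y y').2.2 _; exact: ler_wpM2r.
by rewrite ler_wpM2r// ler_wpDl ?le_max ?lexx ?orbT.
Qed.

Lemma th_bounds :
  nonneg_bounded b' ->
  caseI F G a b b' ls lu th \/ caseII F G a a' b b' ls lu th ->
  exists T, forall m, 0 <= th m <= T.
Proof.
move=> [b'0 _] [[_ _ /sup_lt1_le[r /andP[r0 r1] abr] _ thE]|[_ _ _ _ thE]].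
  exists ((1 - r)^-1) => m; rewrite thE.
  have h1 : 0 < 1 - r by rewrite subr_gt0.
  have h2 : 1 - r <= 1 - a m * b' (u m) by rewrite lerD2l lerN2.
  have h3 := lt_le_trans h1 h2.
  by rewrite invr_ge0 ltW//= lef_pV2.
by exists 1 => m; rewrite thE ler01 lexx.
Qed.

Hypothesis f_lip : forall m x x', `|f m x - f m x'| <= b' m * `|x - x'|.
Hypothesis xi_lip : forall m (x x' : X m), `|xi m x - xi m x'| <= ls m * `|x - x'|.
Hypothesis f_inv : forall m x,
  F m (x, f (u m) (xi m x)) = xi m x /\ G m (x, f (u m) (xi m x)) = f m x.
Hypothesis b'_ge0 : forall m, 0 <= b' m.
Hypothesis lu_ge0 : forall m, 0 <= lu m.

Lemma corr_graph m (x : X m) : corr F G (x, f m x) (xi m x, f (u m) (xi m x)).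
Proof. by case: (f_inv x) => h1 h2; split=> /=; rewrite ?h1 ?h2. Qed.

(* [P m c] says that cones of aperture [c] are admissible in the fiber of [m].
   In case (I) only [c = 0] is used; in case (II) the aperture in the fiber of
   [u m] is [a' m], which depends on [m] and not only on [u m]. *)
Definition cone_transfer (P : M -> R -> Prop) := forall m c, P m c ->
  exists2 c', P (u m) c' & forall t p1 p2, @corr R M u X Y F G m p1 p2 ->
    near_graph (f (u m)) c' t p2 ->
    near_graph (f m) c (th m * lu m * t) p1.

(** Aperture 0 is admissible in every fiber because the final estimate tests only the vertical line
    through the apex. *)
Definition cone_family r cM (P : M -> R -> Prop) :=
  [/\ forall m, P m 0, 0 <= r < 1, 0 <= cM,
      forall m c, P m c -> [/\ 0 <= c, c <= cM & b' m * c <= r]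
    & cone_transfer P].

(** Let [d] be the distance from [y2] to the graph over [xi m x]. [F] displaces the first coordinate
    by at most [a m * d], along which the graph varies by at most [b' (u m) * a m * d]; hence
    [d <= t + a m * b' (u m) * d], and solving for [d] produces [th m]. *)
Lemma cone_familyI : caseI F G a b b' ls lu th ->
  exists r cM P, cone_family r cM P.
Proof.
move=> [_ AB /sup_lt1_le[r r01 abr] _ thE].
exists r, 0, (fun _ c => c = 0); split=> // [m c ->|m _ ->].
  by rewrite mulr0; case/andP: r01.
exists 0 => // t [x y] [x2 y2] [/= -> ->] H x'; rewrite /= mul0r normr_le0.
rewrite subr_eq0 => /eqP <-.
have [AF AG] := (AB m).1 x.
rewrite -(f_inv x).2; apply: le_trans (lipschitz_le AG _ _) _.
rewrite [th m * _]mulrC -mulrA ler_wpM2l//.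
have ab1 : 0 < 1 - a m * b' (u m).
  by rewrite subr_gt0 (le_lt_trans (abr m))//; case/andP: r01.
rewrite thE ler_pdivlMl//.
set d := `|y2 - _|.
have h1 : `|F m (x, y2) - xi m x| <= a m * d.
  by rewrite -{1}(f_inv x).1; apply: lipschitz_le AF _ _.
have h2 : d <= `|y2 - f (u m) (F m (x, y2))| + b' (u m) * `|F m (x, y2) - xi m x|.
  rewrite /d -(subrKA (f (u m) (F m (x, y2))) y2 (- f _ _)).
  by apply: le_trans (ler_normD _ _) _; rewrite lerD2l.
have h3 : `|y2 - f (u m) (F m (x, y2))| <= t.
  by apply: H; rewrite /= subrr normr0 mul0r.
have := ler_wpM2l (b'_ge0 (u m)) h1; lra.
Qed.

(** Condition (A) compares the given pair with the pair of graph points over [x']. It applies since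
    [c <= a m], and puts the image in the cone of aperture [a' m], which is admissible because
    [a' m <= a (u m)] and [a' m * b' (u m) <= r]. *)
Lemma cone_familyII : caseII F G a a' b b' ls lu th ->
  exists r cM P, cone_family r cM P.
Proof.
move=> [[[a0 _] [a'0 [Ba' a'B]]] AB /sup_lt1_le[r r01 abr] aa thE].
have [r0 r1] := andP r01.
exists r, (Num.max 0 Ba'),
  (fun m c => [/\ 0 <= c, c <= Num.max 0 Ba', c <= a m & b' m * c <= r]).
have cM0 : 0 <= Num.max 0 Ba' by rewrite le_max lexx.
split=> //; first by move=> m; rewrite mulr0 a0.
  by move=> m c [].
move=> m c [c0 _ ca _].
exists (a' m); first split=> //.
- by rewrite le_max a'B orbT.
- exact: (aa m).1.
- by rewrite mulrC.
move=> t [x y] [x2 y2] xy12 H x' /= xx'.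
have [h1 h2] := (AB m).1 _ _ _ _ _ _ _ _ xy12 (corr_graph x')
  (le_trans xx' (ler_wpM2r (normr_ge0 _) ca)).
by rewrite thE mul1r (le_trans h2)// ler_wpM2l// H.
Qed.

Lemma cocycleS (g : M -> R) n m : cocycle u g n.+1 m = g m * cocycle u g n (u m).
Proof.
rewrite /cocycle big_ord_recl /=; congr (_ * _).
by apply: eq_bigr => k _; rewrite -iterS iterSr.
Qed.

Lemma sum_cocycleS (g : M -> R) N m : \sum_(k < N.+1) cocycle u g k m =
  1 + g m * \sum_(k < N) cocycle u g k (u m).
Proof.
rewrite big_ord_recl {1}/cocycle big_ord0 mulr_sumr; congr (_ + _).
by apply: eq_bigr => k _; exact: cocycleS.
Qed.

Lemma near_graph_parallelogram_sum (r cM M0 L T Bb Bs Bu gamma theta : R)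
    (P : M -> R -> Prop) :
  cone_family r cM P -> 0 <= M0 -> 0 <= L -> 0 < gamma -> 0 < theta <= 1 ->
  (forall m, [/\ b' m <= Bb, 0 <= ls m <= Bs, lu m <= Bu & 0 <= th m <= T]) ->
  (forall m z p q,
    `|F m (z + p + q) - F m (z + p) - F m (z + q) + F m z|
      <= M0 * `|q| `^ gamma * `|p| /\
    `|G m (z + p + q) - G m (z + p) - G m (z + q) + G m z|
      <= M0 * `|q| `^ gamma * `|p|) ->
  (forall m, (forall z z', `|F m z - F m z'| <= L * `|z - z'|) /\
    (forall z z', `|G m z - G m z'| <= L * `|z - z'|)) ->
  let g m := th m * (ls m * lu m) in
  let h m := (ls m `^ gamma) `^ theta * g m in
  exists2 K, 0 <= K & forall N m c (x0 x1 x2 : X m) A B, P m c ->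
    `|x1 - x0| <= A -> `|x2 - x0| <= B ->
    near_graph (f m) c (K * A * (B `^ (gamma * theta) *
      (\sum_(k < N) cocycle u h k m) + cocycle u g N m))
      (x1 + x2 - x0, f m x1 + f m x2 - f m x0).
Proof.
move=> [P0 /andP[r0 r1] cM0 Pc Pstep] M00 L0 ga0 t01 Hb HQ HL g h.
have r1' : 0 < 1 - r by rewrite subr_gt0.
have [[m0 _]|noM] := pselect (exists m : M, True); last first.
  by exists 0 => // N m; case: noM; exists m.
have [Bb0 Bs0 Bu0 T0] : [/\ 0 <= Bb, 0 <= Bs, 0 <= Bu & 0 <= T].
  have [h1 /andP[h2 h3] h4 /andP[h5 h6]] := Hb m0.
  by split; [exact: le_trans (b'_ge0 m0) h1|exact: le_trans h2 h3|
    exact: le_trans (lu_ge0 m0) h4|exact: le_trans h5 h6].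
(* [K1] is a Lipschitz constant of the map [w] below, [KE] controls second differences of [F] and
   [G] along [w], [Kp] is the price of displacing an apex, and [Kb] starts the induction. *)
pose K1 := 1 + Bb * Bs; pose KE := M0 * K1 `^ gamma * K1 + 2 * L * K1.
pose Kp := 1 + Bb * (1 + cM) / (1 - r).
pose Kb := 2 * Bb / (1 - r).
have K10 : 0 <= K1 by rewrite addr_ge0 ?mulr_ge0.
have KE0 : 0 <= KE by rewrite /KE addr_ge0 ?mulr_ge0 ?powR_ge0.
have iq0 : 0 <= (1 - r)^-1 by rewrite invr_ge0 ltW.
have Kp0 : 0 <= Kp by rewrite /Kp addr_ge0 ?mulr_ge0 ?addr_ge0.
have Kb0 : 0 <= Kb by rewrite /Kb !mulr_ge0.
have perturb m c t x y E E' e : P m c -> `|E| <= e -> `|E'| <= e ->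
    near_graph (f m) c t (x, y) ->
    near_graph (f m) c (t + Kp * e) (x + E, y + E').
  move=> Pm Ee E'e H; have [c0 cc bc] := Pc _ _ Pm.
  have := near_graph_perturb (@f_lip m) (b'_ge0 m) c0 bc r1 Ee E'e H.
  apply: near_graph_le; rewrite lerD2l ler_wpM2r ?(le_trans (normr_ge0 _) Ee)//.
  rewrite /Kp lerD2l; apply: ler_wpM2r; first by [].
  by apply: ler_pM; rewrite ?addr_ge0 ?lerD2l//; case: (Hb m).
exists ((1 + T * Bu) * Kp * KE + Kb).
  by rewrite addr_ge0// !mulr_ge0// addr_ge0// mulr_ge0.
(* The aperture [c] stays quantified in the induction, since each step moves to the aperture that
   [cone_transfer] supplies over [u m]. *)
set K := _ + Kb; elim=> [|N IH] m c x0 x1 x2 A B Pm x1A x2B.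
  have [c0 cc bc] := Pc _ _ Pm; have A0 := le_trans (normr_ge0 _) x1A.
  have := near_graph_parallelogram (x2 := x2) (@f_lip m) (b'_ge0 m) c0 bc r1 x1A.
  apply: near_graph_le; rewrite big_ord0 mulr0 add0r /cocycle big_ord0 mulr1.
  rewrite ler_wpM2r//; apply: (@le_trans _ _ Kb).
    rewrite ler_wpM2r // ler_wpM2l//; by case: (Hb m).
  by rewrite lerDr !mulr_ge0// addr_ge0// mulr_ge0.
have A0 := le_trans (normr_ge0 _) x1A.
have B0 := le_trans (normr_ge0 _) x2B.
have [hb /andP[ls0 lsB] luB /andP[th0 thT]] := Hb m.
have [c' Pc' transfer] := Pstep _ _ Pm.
have xiA (x x' : X m) D : `|x - x'| <= D -> `|xi m x - xi m x'| <= ls m * D.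
  by move=> H; apply: le_trans (xi_lip _ _) _; rewrite ler_wpM2l.
have {IH} IH := IH _ _ _ _ _ _ _ Pc' (xiA _ _ _ x1A) (xiA _ _ _ x2B).
pose w x := (x, f (u m) (xi m x)).
have wA x x' D : `|x - x'| <= D -> `|w x - w x'| <= K1 * D.
  move=> H; have D0 := le_trans (normr_ge0 _) H; rewrite prod_normE /= ge_max.
  rewrite mulrDl mul1r ler_wpDr ?mulr_ge0//=.
  rewrite ler_wpDl//; apply: le_trans (f_lip _ _) _; rewrite -mulrA.
  apply: ler_pM => //; first by case: (Hb (u m)).
  by apply: le_trans (xiA _ _ _ H) _; rewrite ler_wpM2r.
pose y := f (u m) (xi m x1) + f (u m) (xi m x2) - f (u m) (xi m x0).
pose x := x1 + x2 - x0.
have wE : w x0 + (w x1 - w x0) + (w x2 - w x0) = (x, y).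
  by rewrite [w x0 + _]addrC subrK addrA.
have w1E : w x0 + (w x1 - w x0) = w x1 by rewrite addrC subrK.
have w2E : w x0 + (w x2 - w x0) = w x2 by rewrite addrC subrK.
have Fw x' : F m (w x') = xi m x' by case: (f_inv x').
have Gw x' : G m (w x') = f m x' by case: (f_inv x').
pose e := KE * (A * B `^ (gamma * theta)).
have interp (Z : normedModType R) (k : X m * Y (u m) -> Z) :
    (forall z z', `|k z - k z'| <= L * `|z - z'|) ->
    (forall z p q, `|k (z + p + q) - k (z + p) - k (z + q) + k z|
      <= M0 * `|q| `^ gamma * `|p|) ->
    `|k (x, y) - (k (w x1) + k (w x2) - k (w x0))| <= e.
  move=> kL kQ.
  have := second_difference_interp M00 L0 K10 ga0 t01 A0 B0 kL
    (kQ (w x0) (w x1 - w x0) (w x2 - w x0)) (wA _ _ _ x1A) (wA _ _ _ x2B).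
  by rewrite wE w1E w2E !opprD opprK !addrA.
have EF := interp _ _ (HL m).1 (fun z p q => (HQ m z p q).1).
have EG := interp _ _ (HL m).2 (fun z p q => (HQ m z p q).2).
rewrite !Fw in EF; rewrite !Gw in EG.
have e0 : 0 <= e by rewrite !mulr_ge0// powR_ge0.
have Z0 (Z : normedModType R) : `|0 : Z| <= e by rewrite normr0.
(* Over [u m] the second coordinate of the fourth vertex is exactly [y]; only the first has to be
   corrected, to [F m (x, y)]. Back over [m] the first coordinate is exact and the error is that of
   [G]. *)
have := perturb _ _ _ _ _ _ 0 _ Pc' EF (Z0 _) IH.
rewrite [_ + (F m _ - _)]addrC subrK addr0 => H2.
have corr12 : @corr _ _ u X Y F G m (x, G m (x, y)) (F m (x, y), y) by split.
have := transfer _ _ _ corr12 H2.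
move=> /(perturb _ _ _ _ _ 0 _ _ Pm (Z0 _)).
move=> /(_ (f m x1 + f m x2 - f m x0 - G m (x, y))).
rewrite distrC => /(_ EG); rewrite addr0 [G m _ + _]addrC subrK.
apply: near_graph_le.
rewrite sum_cocycleS cocycleS; set S := \sum_(_ < N) _; set gN := cocycle u g N _.
rewrite powRM// powRrM.
have -> : h m = (ls m `^ gamma) `^ theta * g m by [].
set la := (ls m `^ gamma) `^ theta; rewrite /e.
set Ba := B `^ (gamma * theta).
have Ba0 : 0 <= Ba by rewrite powR_ge0.
have key : (1 + th m * lu m) * Kp * KE <= K.
  rewrite /K ler_wpDr// ler_wpM2r// ler_wpM2r// lerD2l.
  by apply: ler_pM.
have := ler_wpM2r (mulr_ge0 A0 Ba0) key; rewrite -subr_ge0 => key'.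
(* The gap between the two sides is exactly [(K - (1 + th m * lu m) * Kp * KE) * (A * Ba)]. *)
rewrite -subr_ge0; apply: le_trans key' _; rewrite le_eqVlt /g; apply/orP; left.
by apply/eqP; ring.
Qed.

End InvariantGraph.

(** * Submultiplicative sequences and geometric sums *)

Section Growth.
Context {R : realType}.

Lemma powR_expn_inv (x : R) n : 0 <= x -> (0 < n)%N -> (x `^ n%:R^-1) ^+ n = x.
Proof.
move=> x0 n0; rewrite -powR_mulrn ?powR_ge0// -powRrM mulVf ?powRr1//.
by rewrite pnatr_eq0 -lt0n.
Qed.

Lemma powR_inv_le (x r : R) n : 0 <= x -> 0 <= r -> (0 < n)%N ->
  (x `^ n%:R^-1 <= r) = (x <= r ^+ n).
Proof.
move=> x0 r0 n0; rewrite -[in RHS](powR_expn_inv x0 n0).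
by rewrite ler_pXn2r ?nnegrE ?powR_ge0.
Qed.

Lemma expr_ge_lin (x : R) n : 0 <= x -> 1 + n%:R * x <= (1 + x) ^+ n.
Proof.
move=> x0; elim: n => [|n IH]; first by rewrite mul0r addr0 expr0.
rewrite exprS; have := ler_wpM2l (addr_ge0 ler01 x0) IH.
have := mulr_ge0 (ler0n R n) (mulr_ge0 x0 x0).
by rewrite -natr1; lra.
Qed.

Lemma expr_near_ge (D x : R) : 1 < x -> \forall n \near \oo, D <= x ^+ n.
Proof.
move=> x1; have x0 : 0 < x - 1 by rewrite subr_gt0.
exists (Num.bound (D / (x - 1))) => // n /= hn.
rewrite -[x](subrKC 1); apply: le_trans (expr_ge_lin n (ltW x0)).
apply: (@le_trans _ _ (n%:R * (x - 1))); last by rewrite lerDr.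
rewrite -ler_pdivrMr//; apply: le_trans (ler_norm _) _.
apply: le_trans (_ : (Num.bound (D / (x - 1)))%:R <= _); last by rewrite ler_nat.
by apply: ltW; have := archi_boundP (normr_ge0 (D / (x - 1))); rewrite /Num.bound normr_id.
Qed.

Lemma submultiplicative_le (s : nat -> R) n q k : (forall n, 0 <= s n) ->
  (forall n k, s (n + k)%N <= s n * s k) -> s (q * n + k)%N <= s n ^+ q * s k.
Proof.
move=> s0 sD; elim: q => [|q IH]; first by rewrite mul0n expr0 mul1r.
rewrite mulSn -addnA exprS -mulrA.
by apply: le_trans (sD _ _) _; rewrite ler_wpM2l.
Qed.

(** The multiplicative form of Fekete's lemma. The infimum starts at rank 1: at rank 0 the exponent
    [0^-1] is 0 and the root is 1 whatever [s 0] is. *)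
Lemma fekete (s : nat -> R) : (forall n, 0 <= s n) ->
  (forall n k, s (n + k)%N <= s n * s k) ->
  s n `^ n%:R^-1 @[n --> \oo] --> inf [set s n.+1 `^ n.+1%:R^-1 | n in [set: nat]].
Proof.
move=> s0 sD; set S := [set _ | _ in _]; set l := inf S.
have Sinf : has_inf S.
  split; first by exists (s 1 `^ 1%:R^-1), 0.
  by exists 0 => _ [n _ <-]; exact: powR_ge0.
have l0 : 0 <= l by apply: lb_le_inf; [case: Sinf|move=> _ [n _ <-]; exact: powR_ge0].
apply/cvgrPdist_le => e e0.
have [_ [n0 _ <-] n0l] : exists2 x, S x & x < l + e / 2.
  by apply: inf_adherent => //; rewrite divr_gt0.
set n1 := n0.+1 in n0l; pose p := l + e / 2.
have p0 : 0 < p by rewrite ltr_wpDl// divr_gt0.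
have sn1 : s n1 <= p ^+ n1 by rewrite -powR_inv_le// ltW.
(* [D] absorbs every possible remainder of [n] modulo [n1]; as [(l + e) / p] exceeds 1, its powers
   eventually dominate [D]. *)
pose D := \sum_(k < n1) s k / p ^+ k.
have D0 : 0 <= D by rewrite sumr_ge0// => k _; rewrite divr_ge0// exprn_ge0// ltW.
have sle n : s n <= D * p ^+ n.
  have kn1 : (n %% n1 < n1)%N by rewrite ltn_mod.
  rewrite {1}(divn_eq n n1); apply: le_trans (submultiplicative_le _ _ _ s0 sD) _.
  apply: (@le_trans _ _ ((p ^+ n1) ^+ (n %/ n1) * s (n %% n1)%N)).
    by rewrite ler_wpM2r// lerXn2r// nnegrE// exprn_ge0// ltW.
  rewrite -exprM {3}(divn_eq n n1) exprD mulnC mulrCA ler_wpM2l ?exprn_ge0 ?(ltW p0)//.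
  rewrite -ler_pdivrMr ?exprn_gt0// /D (bigD1 (Ordinal kn1))//= lerDl.
  by apply: sumr_ge0 => k _; rewrite divr_ge0// exprn_ge0// ltW.
have le1 : 1 < (l + e) / p.
  by rewrite ltr_pdivlMr// mul1r ltrD2l ltr_pdivrMr// ltr_pMr// ltr1n.
near=> n.
have n0' : (0 < n)%N by near: n; exists 1.
have lle : l <= s n `^ n%:R^-1.
  apply: ge_inf; first by case: Sinf.
  by exists n.-1 => //; rewrite prednK.
have : s n `^ n%:R^-1 <= l + e.
  rewrite powR_inv_le ?addr_ge0 ?(ltW e0)//; apply: le_trans (sle n) _.
  rewrite -ler_pdivlMr ?exprn_gt0// -expr_div_n.
  by near: n; exact: expr_near_ge.
by rewrite distrC ger0_norm ?subr_ge0// lerBlDl.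
Unshelve. all: by end_near. Qed.

Lemma sum_eventually_geometric (x : nat -> R) (B r : R) n0 :
  0 <= B -> 0 <= r < 1 -> (forall k, x k <= B ^+ k) ->
  (forall k, (n0 <= k)%N -> x k <= r ^+ k) ->
  forall n, \sum_(k < n) x k <= \sum_(k < n0) B ^+ k + (1 - r)^-1.
Proof.
move=> B0 /andP[r0 r1] xB xr n; have r1' : 0 < 1 - r by rewrite subr_gt0.
(* Both parts of the bound are kept as partial sums so that the induction closes: the term of rank
   [n] is paid by [B ^+ n] before [n0] and by [r ^+ n] afterwards. *)
suff H : \sum_(k < n) x k <=
    \sum_(k < minn n n0) B ^+ k + (1 - r ^+ n) / (1 - r).
  apply: le_trans H _; apply: lerD.
    have mono p q : (p <= q)%N -> \sum_(k < p) B ^+ k <= \sum_(k < q) B ^+ k.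
      move=> /subnKC <-; rewrite big_split_ord /= lerDl.
      by apply: sumr_ge0 => k _; rewrite exprn_ge0.
    exact/mono/geq_minr.
  by rewrite ler_pdivrMr// mulVf ?gt_eqF// gerBl exprn_ge0.
elim: n => [|n IH]; first by rewrite min0n !big_ord0 expr0 subrr mul0r addr0.
have rE : (1 - r ^+ n.+1) / (1 - r) = (1 - r ^+ n) / (1 - r) + r ^+ n.
  by rewrite exprS; field; rewrite gt_eqF.
have rn0 : 0 <= r ^+ n by rewrite exprn_ge0.
rewrite big_ord_recr /= rE addrA; have [nn0|n0n] := ltnP n n0.
  rewrite (minn_idPl nn0) big_ord_recr /=.
  rewrite (minn_idPl (ltnW nn0)) in IH; have := xB n; lra.
rewrite (minn_idPr (leqW n0n)); rewrite (minn_idPr n0n) in IH.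
by have := xr n n0n; lra.
Qed.

End Growth.

(** * Cocycles over [u] and their sup Lyapunov numbers *)

Section Cocycles.
Context {R : realType} {M : Type} (u : M -> M).
Implicit Types (g : M -> R) (m : M).

Lemma cocycle_ge0 g n m : (forall m, 0 <= g m) -> 0 <= cocycle u g n m.
Proof. by move=> g0; exact: prodr_ge0. Qed.

Lemma cocycle_le_expr g B n m :
  (forall m, 0 <= g m) -> (forall m, g m <= B) -> cocycle u g n m <= B ^+ n.
Proof.
move=> g0 gB; elim: n m => [|n IH] m; first by rewrite /cocycle big_ord0 expr0.
by rewrite cocycleS exprS ler_pM// cocycle_ge0.
Qed.

Lemma cocycleD g n k m :
  cocycle u g (n + k) m = cocycle u g n m * cocycle u g k (iter n u m).
Proof.
elim: n m => [|n IH] m; first by rewrite /cocycle big_ord0 mul1r.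
by rewrite addSn !cocycleS IH mulrA iterSr.
Qed.

Lemma cocycleM g g' n m :
  cocycle u (fun m => g m * g' m) n m = cocycle u g n m * cocycle u g' n m.
Proof. exact: big_split. Qed.

Lemma cocycle_powR g t n m : (forall m, 0 <= g m) ->
  cocycle u (fun m => g m `^ t) n m = cocycle u g n m `^ t.
Proof.
move=> g0; elim: n m => [|n IH] m; first by rewrite /cocycle !big_ord0 powR1.
by rewrite !cocycleS IH powRM// cocycle_ge0.
Qed.

Lemma orbit_has_sup g n m : nonneg_bounded g ->
  has_sup [set cocycle u g n (iter N u m) | N in [set: nat]].
Proof.
move=> [g0 [B gB]]; split; first by exists (cocycle u g n m), 0.
by exists (B ^+ n) => _ [N _ <-]; exact: cocycle_le_expr.
Qed.

Lemma orbit_growth_cocycle_le g n m r : nonneg_bounded g -> (0 < n)%N ->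
  orbit_growth u g n m <= r -> forall N, cocycle u g n (iter N u m) <= r ^+ n.
Proof.
move=> gb n0 gr N; have r0 : 0 <= r by apply: le_trans gr; exact: powR_ge0.
have sup0 : cocycle u g n (iter N u m) <=
    sup [set cocycle u g n (iter N u m) | N in [set: nat]].
  by apply: ub_le_sup; [case: (orbit_has_sup n m gb)|exists N].
apply: (le_trans sup0); rewrite -powR_inv_le//.
exact: (le_trans (cocycle_ge0 _ _ gb.1) sup0).
Qed.

(** The suprema over a forward orbit are submultiplicative, because the second factor of a split
    cocycle starts at a later point of the same orbit. The [lim] in [sup_lyapunov] is thus a genuine
    limit. *)
Lemma orbit_growth_cvg g m : nonneg_bounded g ->
  orbit_growth u g n m @[n --> \oo] --> sup_lyapunov u g m.
Proof.
move=> gb; pose s n := sup [set cocycle u g n (iter N u m) | N in [set: nat]].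
have cs n N : cocycle u g n (iter N u m) <= s n.
  by apply: ub_le_sup; [case: (orbit_has_sup n m gb)|exists N].
have g0 := gb.1.
have s0 n : 0 <= s n by exact: le_trans (cocycle_ge0 _ _ g0) (cs n 0).
have := @fekete R s s0 _; move=> H.
have sD n k : s (n + k)%N <= s n * s k.
  apply: ge_sup; first by case: (orbit_has_sup (n + k) m gb).
  move=> _ [N _ <-]; rewrite cocycleD -iterD.
  by apply: ler_pM => //; exact: cocycle_ge0.
have {H}/cvgP := H sD; exact.
Qed.

(** The rank [n0] depends on [m] but serves its whole forward orbit, since the supremum over the
    orbit is part of the growth rate. *)
Lemma sup_lyapunov_cocycle_le g m r : nonneg_bounded g -> sup_lyapunov u g m < r ->
  exists n0, forall n, (n0 <= n)%N ->
    forall N, cocycle u g n (iter N u m) <= r ^+ n.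
Proof.
move=> gb gr; have [n0 _ H] := cvgr_lt _ (orbit_growth_cvg (m := m) gb) _ gr.
exists n0.+1 => n hn; apply: orbit_growth_cocycle_le => //.
  exact: leq_ltn_trans hn.
by apply/ltW/H; exact: ltnW.
Qed.

Lemma sup_lyapunov_ge0 g m : nonneg_bounded g -> 0 <= sup_lyapunov u g m.
Proof.
move=> gb; apply: (ler_cvg_to (@cvg_cst _ _ _ _ _) (orbit_growth_cvg (m := m) gb)).
by near=> n; exact: powR_ge0.
Unshelve. all: by end_near. Qed.

(** Leaves room above both Lyapunov numbers, so that each of the two cocycles is eventually
    dominated by a power while the combined ratio stays below 1. *)
Lemma powR_mul_lt1 (l t theta : R) : 0 <= l -> 0 <= t -> 0 < theta ->
  l `^ theta * t < 1 -> exists l' t', [/\ l < l', t < t' & l' `^ theta * t' < 1].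
Proof.
move=> l0 t0 h0 lt1; set p := l `^ theta in lt1.
have p0 : 0 <= p by exact: powR_ge0.
pose t' := t + (1 - p * t) / (2 * (p + 1)).
have p1 : 0 < 2 * (p + 1) by rewrite mulr_gt0// ltr_wpDl.
have tt' : t < t' by rewrite ltrDl divr_gt0// subr_gt0.
have t'0 : 0 < t' by exact: le_lt_trans tt'.
have pt' : p * t' < 1.
  have -> : p * t' = p * t + (p / (2 * (p + 1))) * (1 - p * t) by rewrite /t'; ring.
  have : p / (2 * (p + 1)) < 1 by rewrite ltr_pdivrMr//; lra.
  by rewrite -subr_gt0 in lt1; move=> ?; nra.
(* [w] is the critical value, at which the product with [t'] equals 1; the midpoint of [l] and [w]
   is then strictly between. *)
pose w := t'^-1 `^ theta^-1.
have wE : w `^ theta = t'^-1 by rewrite /w -powRrM mulVf ?gt_eqF// powRr1// invr_ge0 ltW.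
have lw : l < w.
  have -> : l = p `^ theta^-1 by rewrite /p -powRrM mulfV ?gt_eqF// powRr1.
  apply: gt0_ltr_powR; rewrite ?nnegrE ?invr_gt0 ?invr_ge0 ?(ltW t'0)//.
  by rewrite -[ltRHS]mul1r ltr_pdivlMr.
exists ((l + w) / 2), t'; split=> //; first by rewrite ltr_pdivlMr//; lra.
rewrite -ltr_pdivlMr// mul1r -wE; apply: gt0_ltr_powR => //.
- by rewrite nnegrE divr_ge0// addr_ge0// powR_ge0.
- by rewrite nnegrE powR_ge0.
- by rewrite ltr_pdivrMr//; lra.
Qed.

Lemma cocycle_sum_bounded (h : M -> R) m r n0 : nonneg_bounded h -> 0 <= r < 1 ->
  (forall n, (n0 <= n)%N -> forall N, cocycle u h n (iter N u m) <= r ^+ n) ->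
  exists C, forall N n, \sum_(k < n) cocycle u h k (iter N u m) <= C.
Proof.
move=> [h0 [B hB]] r01 hr.
have B0 : 0 <= B := le_trans (h0 m) (hB m).
exists (\sum_(k < n0) B ^+ k + (1 - r)^-1) => N n.
apply: (@sum_eventually_geometric _ (cocycle u h ^~ (iter N u m)) B r n0 B0 r01) => k.
  exact: cocycle_le_expr.
by move=> /hr.
Qed.

(** Every alternative of the spectral condition ends in eventual geometric decay along the orbit.
    When the two Lyapunov numbers are separate, the cocycle of the product splits and each factor is
    bounded on its own. *)
Lemma spectral_cocycle_le th (Q : Prop) lam theta g :
  0 < theta -> nonneg_bounded lam -> nonneg_bounded (fun m => th m * g m) ->
  spectral_lt1 u th Q lam theta g -> forall m, exists2 r, 0 <= r < 1 &
    exists n0, forall n, (n0 <= n)%N -> forall N,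
      cocycle u (fun m => lam m `^ theta * (th m * g m)) n (iter N u m) <= r ^+ n.
Proof.
move=> t0 lamb tgb [hP hnP] m.
have hb : nonneg_bounded (fun m => lam m `^ theta * (th m * g m)).
  have [[l0 [L lL]] [g0 [B gB]]] := (lamb, tgb).
  split=> [k|]; first by rewrite mulr_ge0// powR_ge0.
  exists (L `^ theta * B) => k; apply: ler_pM => //; first exact: powR_ge0.
  apply: ge0_ler_powR; rewrite ?nnegrE ?(ltW t0)//.
  exact: le_trans (lL k).
have [/hP|/hnP] := pselect [\/ Q, exact_lyapunov u (fun m => th m * g m) | theta = 1].
  case=> /sup_lt1_le[r /andP[r0 r1] hr].
    by exists r; rewrite ?r0//; exists 0 => n _ N; apply: cocycle_le_expr; case: hb.
  exists ((r + 1) / 2); first by apply/andP; split; lra.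
  apply: sup_lyapunov_cocycle_le => //; apply: le_lt_trans (hr m) _.
  by rewrite ltr_pdivlMr//; lra.
move=> /sup_lt1_le[r /andP[r0 r1] /(_ m) hr].
have [l [t [hl ht lt1]]] := powR_mul_lt1 (sup_lyapunov_ge0 m lamb)
  (sup_lyapunov_ge0 m tgb) t0 (le_lt_trans hr r1).
have [n1 H1] := sup_lyapunov_cocycle_le lamb hl.
have [n2 H2] := sup_lyapunov_cocycle_le tgb ht.
have t0' := le_trans (sup_lyapunov_ge0 m tgb) (ltW ht).
exists (l `^ theta * t); first by rewrite lt1 mulr_ge0// powR_ge0.
exists (maxn n1 n2) => n; rewrite geq_max.
move=> /andP[/H1 h1 /H2 h2] N; have l0 := le_trans (sup_lyapunov_ge0 m lamb) (ltW hl).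
have [lam0 _] := lamb; rewrite cocycleM cocycle_powR// exprMn -powR_expr//.
apply: ler_pM => //; first exact: powR_ge0.
  by apply: cocycle_ge0; case: tgb.
apply: ge0_ler_powR; rewrite ?nnegrE ?(ltW t0) ?exprn_ge0//.
by apply: cocycle_ge0; case: lamb.
Qed.

End Cocycles.

(** * Regularity of the invariant graph *)

Lemma invariant_graph_C1 (R : realType) (M : Type) (u : M -> M)
  (X Y : M -> completeNormedModType R)
  (F : forall m, X m * Y (u m) -> X (u m))
  (G : forall m, X m * Y (u m) -> Y m)
  (iX : forall m, X m) (iY : forall m, Y m)
  (a a' b b' ls lu th : M -> R)
  (f : forall m, X m -> Y m) (xi : forall m, X m -> X (u m))
  (M0 gamma theta : R) :
  caseI F G a b b' ls lu th \/ caseII F G a a' b b' ls lu th ->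
  [/\ nonneg_bounded b, nonneg_bounded b',
      nonneg_bounded ls & nonneg_bounded lu] ->
  sup_lt1 (fun m => th m * (ls m * lu m)) ->
  invariant_graph F G b' ls iX iY f xi ->
  (forall m, C1 (F m) /\ C1 (G m)) ->
  0 < M0 -> 0 < gamma -> 0 < theta <= 1 ->
  (forall m, holder_diff M0 gamma (F m) /\ holder_diff M0 gamma (G m)) ->
  let h m := (ls m `^ gamma) `^ theta * (th m * (ls m * lu m)) in
  exists2 K, 0 <= K & forall m C, (forall n, \sum_(k < n) cocycle u h k m <= C) ->
    C1 (f m) /\ holder_diff (K * C) (gamma * theta) (f m).
Proof.
move=> hcase [bb b'b lsb lub] /sup_lt1_le[r /andP[r0 r1] gr] hf hC1 M00 ga0 t01 hH h.
have [L L0 HL] := generating_map_lipschitz bb b'b lsb lub hcase.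
have [T thT] := th_bounds b'b hcase.
have [[b'0 [Bb b'B]] [ls0 [Bs lsB]] [lu0 [Bu luB]]] := And3 b'b lsb lub.
have f_lip m x x' : `|f m x - f m x'| <= b' m * `|x - x'|.
  by case: (hf m) => /lipschitz_le.
have xi_lip m x x' : `|xi m x - xi m x'| <= ls m * `|x - x'|.
  by case: (hf m) => _ _ /lipschitz_le.
have f_inv m x : F m (x, f (u m) (xi m x)) = xi m x /\
    G m (x, f (u m) (xi m x)) = f m x by case: (hf m).
have [q0 [cM [P fam]]] : exists q cM P, cone_family F G f b' lu th q cM P.
  case: hcase => H; first exact: (cone_familyI f_lip f_inv b'0 lu0 H).
  exact: (cone_familyII f_inv lu0 H).
have Hb m : [/\ b' m <= Bb, 0 <= ls m <= Bs, lu m <= Bu & 0 <= th m <= T].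
  by split=> //; rewrite ls0 lsB.
have HQ m z p q : `|F m (z + p + q) - F m (z + p) - F m (z + q) + F m z|
      <= M0 * `|q| `^ gamma * `|p| /\
    `|G m (z + p + q) - G m (z + p) - G m (z + q) + G m z|
      <= M0 * `|q| `^ gamma * `|p|.
  by have [[? ?] [? ?]] := (hC1 m, hH m); split; exact: second_difference_le.
have [K K0 HK] := near_graph_parallelogram_sum f_lip xi_lip f_inv b'0 lu0 fam
  (ltW M00) L0 ga0 t01 Hb HQ HL.
(* [K] is fixed before [m] and [C], so the Hölder constant is uniform wherever the cocycle sums
   are. *)
exists K => // m C hC; have [P0 _ _ _ _] := fam.
have C0 : 0 <= C by have := hC 0; rewrite big_ord0.
have t0 : 0 < theta by case/andP: t01.
apply: (@second_difference_C1 _ _ _ _ (b' m)); rewrite ?mulr_gt0 ?mulr_ge0//.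
  by move=> x p; apply: le_trans (f_lip _ _ _) _; rewrite [x + p]addrC addrK.
move=> x p p'; set B := `|p'| `^ _.
have B0 : 0 <= B by exact: powR_ge0.
set Q := `|_|.
have QN N : Q <= K * C * B * `|p| + K * `|p| * r ^+ N.
  have x1 : `|x + p - x| <= `|p| by rewrite [x + p]addrC addrK.
  have x2 : `|x + p' - x| <= `|p'| by rewrite [x + p']addrC addrK.
  (* In the cone of aperture 0 the only test point is [x + p + p'], and the vertical distance there
     is the second difference of [f m]. *)
  have := HK N _ _ _ _ _ _ _ (P0 m) x1 x2 (x + p + p').
  have -> : x + p + (x + p') - x = x + p + p' by rewrite addrA addrAC addrK.
  rewrite /= subrr normr0 mul0r lexx distrC => /(_ isT).
  have -> : f m (x + p + p') - (f m (x + p) + f m (x + p') - f m x) =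
    f m (x + p + p') - f m (x + p) - f m (x + p') + f m x.
    by rewrite !opprD opprK !addrA.
  move=> /le_trans; apply.
  have -> : K * C * B * `|p| + K * `|p| * r ^+ N = K * `|p| * (B * C + r ^+ N).
    by ring.
  rewrite ler_wpM2l ?mulr_ge0//; apply: lerD.
    by rewrite ler_wpM2l//; exact: hC.
  apply: cocycle_le_expr => // k.
  by rewrite !mulr_ge0//; case/andP: (thT k).
have lim0 : K * C * B * `|p| + K * `|p| * r ^+ N @[N --> \oo] -->
    K * C * B * `|p| + K * `|p| * 0.
  apply: cvgD; first exact: cvg_cst.
  by apply: cvgM; [exact: cvg_cst|apply: cvg_expr; rewrite ger0_norm].
rewrite mulr0 addr0 in lim0; apply: ler_cvg_to lim0 _; first exact: cvg_cst.
by near=> N; exact: QN.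
Unshelve. all: by end_near. Qed.

(** The spectral condition bounds the cocycle sums along each forward orbit, hence the orbitwise
    constant; a constant for all of [M] is drawn from decay with a rank common to all [m]. *)
Theorem lemma6p11 (R : realType) (M : Type) (u : M -> M)
  (X Y : M -> completeNormedModType R)
  (F : forall m, X m * Y (u m) -> X (u m))
  (G : forall m, X m * Y (u m) -> Y m)
  (iX : forall m, X m) (iY : forall m, Y m)
  (a a' b b' ls lu th : M -> R)
  (f : forall m, X m -> Y m) (xi : forall m, X m -> X (u m))
  (hcase : caseI F G a b b' ls lu th \/ caseII F G a a' b b' ls lu th)
  (hbd : [/\ nonneg_bounded b, nonneg_bounded b',
             nonneg_bounded ls & nonneg_bounded lu])
  (hi : invariant_section F G iX iY)
  (hsulu : sup_lt1 (fun m => th m * (ls m * lu m)))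
  (hf : invariant_graph F G b' ls iX iY f xi)
  (hC1 : forall m, C1 (F m) /\ C1 (G m)) :
  (forall M0 gamma theta : R,
     0 < M0 -> 0 < gamma <= 1 -> 0 < theta <= 1 ->
     (forall m, holder_diff M0 gamma (F m) /\ holder_diff M0 gamma (G m)) ->
     spectral_lt1 u th (exists B : R, forall m x, `|xi m x| <= B)
       (fun m => ls m `^ gamma) theta (fun m => ls m * lu m) ->
     let h m := (ls m `^ gamma) `^ theta * (th m * (ls m * lu m)) in
     [/\ forall m, C1 (f m),
         forall m, exists C : R, forall k,
           holder_diff C (gamma * theta) (f (iter k u m))
       & sup_lt1 h \/ uniform_lyapunov_lt1 u h ->
         exists C : R, forall m, holder_diff C (gamma * theta) (f m)]) /\
  ((exists M0 : R, forall m,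
      holder_diff M0 1 (F m) /\ holder_diff M0 1 (G m)) ->
   sup_lt1 (fun m => th m * (ls m ^+ 2 * lu m)) ->
   (forall m, C1 (f m)) /\ exists C : R, forall m, holder_diff C 1 (f m)).
Proof.
have [bb b'b lsb lub] := hbd; have [T thT] := th_bounds b'b hcase.
have [[ls0 [Bs lsB]] [lu0 [Bu luB]]] := conj lsb lub.
split=> [M0 gamma theta M00 /andP[ga0 ga1] t01 hH hspec h|[M0 hM0] hls2].
  have [K K0 HK] := invariant_graph_C1 hcase hbd hsulu hf hC1 M00 ga0 t01 hH.
  rewrite -/h in HK.
  have t0 : 0 < theta by case/andP: t01.
  have lamb : nonneg_bounded (fun m => ls m `^ gamma).
    split=> [m|]; first exact: powR_ge0.
    exists (Bs `^ gamma) => m; apply: ge0_ler_powR; rewrite ?nnegrE ?(ltW ga0)//.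
    exact: le_trans (lsB m).
  have gb : nonneg_bounded (fun m => th m * (ls m * lu m)).
    split=> [m|]; first by rewrite !mulr_ge0//; case/andP: (thT m).
    exists (T * (Bs * Bu)) => m; have /andP[th0 thB] := thT m.
    by rewrite !ler_pM ?mulr_ge0.
  have hb : nonneg_bounded h.
    have [[l0 [L lL]] [g0 [B gB]]] := (lamb, gb).
    split=> [m|]; first by rewrite mulr_ge0// powR_ge0.
    exists (L `^ theta * B) => m; apply: ler_pM => //; first exact: powR_ge0.
    apply: ge0_ler_powR; rewrite ?nnegrE ?(ltW t0)//.
    exact: le_trans (lL m).
  have orb m : exists C, forall N n, \sum_(k < n) cocycle u h k (iter N u m) <= C.
    have [r r01 [n0 Hr]] := spectral_cocycle_le t0 lamb gb hspec m.
    exact: cocycle_sum_bounded hb r01 Hr.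
  split=> [m|m|hu].
  - by have [C HC] := orb m; case: (HK m C (HC 0)).
  - have [C HC] := orb m; exists (K * C) => k.
    by case: (HK _ C (HC k)).
  have [C HC] : exists C, forall m n, \sum_(k < n) cocycle u h k m <= C.
    have [[m0 _]|noM] := pselect (exists m : M, True); last first.
      by exists 0 => m; case: noM; exists m.
    have [B hB] := hb.2; have h0 := hb.1.
    have B0 : 0 <= B := le_trans (h0 m0) (hB m0).
    have [r r01 [n0 hr]] : exists2 r, 0 <= r < 1 &
        exists n0, forall n, (n0 <= n)%N -> forall m, cocycle u h n m <= r ^+ n.
      case: hu => [/sup_lt1_le[r r01 hr]|[r r1 [n0 _ hr]]].
        by exists r => //; exists 0 => n _ m; exact: cocycle_le_expr.
      exists r.
        (* [r] is nonnegative because it bounds a root at the point [m0]. *)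
        rewrite r1 andbT; apply: le_trans (hr n0 _ m0); first exact: powR_ge0.
        exact: leqnn.
      exists n0.+1 => n hn m.
      exact: (orbit_growth_cocycle_le hb (leq_ltn_trans (leq0n _) hn)
        (hr n (ltnW hn) m) 0).
    exists (\sum_(k < n0) B ^+ k + (1 - r)^-1) => m.
    apply: (@sum_eventually_geometric _ (cocycle u h ^~ m) B r n0 B0 r01) => k.
      exact: cocycle_le_expr.
    by move=> hk; exact: hr.
  by exists (K * C) => m; case: (HK m C (HC m)).
(* No sign is assumed on [M0] in this part, so it is enlarged to a positive constant. *)
have M1 : 0 < `|M0| + 1 by rewrite ltr_wpDl.
have h11 : 0 < (1 : R) <= 1 by rewrite ltr01 lexx.
have hH m : holder_diff (`|M0| + 1) 1 (F m) /\ holder_diff (`|M0| + 1) 1 (G m).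
  have mono (V W : normedModType R) (k : V -> W) :
      holder_diff M0 1 k -> holder_diff (`|M0| + 1) 1 k.
    move=> hk z1 z2; apply: le_trans (hk z1 z2) _.
    rewrite lee_fin ler_wpM2r ?powR_ge0//.
    by rewrite (le_trans (ler_norm _))// lerDl.
  by case: (hM0 m) => ? ?; split; apply: mono.
have [K K0] := invariant_graph_C1 hcase hbd hsulu hf hC1 M1 ltr01 h11 hH.
set h := (fun m => _); rewrite mulr1 => HK.
have [r /andP[r0 r1] hr] := sup_lt1_le hls2.
(* For exponents equal to 1 the weight becomes [th * ls ^+ 2 * lu], so the cocycle sums are
   dominated by a geometric series from rank 0. *)
have hE m : h m = th m * (ls m ^+ 2 * lu m).
  by rewrite /h !powRr1//; ring.
have r1' : 0 < 1 - r by rewrite subr_gt0.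
have HC m n : \sum_(k < n) cocycle u h k m <= (1 - r)^-1.
  have h0 k : 0 <= h k.
    by rewrite hE !mulr_ge0// ?exprn_ge0//; case/andP: (thT k).
  have hk k : cocycle u h k m <= r ^+ k.
    by apply: cocycle_le_expr => // j; rewrite hE.
  have := @sum_eventually_geometric _ (cocycle u h ^~ m) r r 0 r0 _ hk (fun k _ => hk k) n.
  by rewrite big_ord0 add0r; apply; rewrite r0.
split=> [m|]; first by case: (HK m _ (HC m)).
by exists (K * (1 - r)^-1) => m; case: (HK m _ (HC m)).
Qed.
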